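(* The map $SE:\mathcal S_1(\mathbb C^3,\mathbb C^3)\to\mathcal S_3(\mathbb C,\mathbb C)$ given by $$SE(F)(z_1,z_2,\lambda)=-\mathcal G_{F(\lambda)}(z_1,z_2),\qquad \lambda\in\mathbb D,\ (z_1,z_2)\in\mathbb D^2,$$ is well defined; that is, for every $F\in\mathcal S_1(\mathbb C^3,\mathbb C^3)$ the function $SE(F)$ is defined on $\mathbb D^3$ and belongs to $\mathcal S_3(\mathbb C,\mathbb C)$.
   Context: $\mathbb D$ is the open unit disc. $\mathcal S_1(\mathbb C^3,\mathbb C^3)$ is the set of analytic $3\times3$ matrix functions $F=(F_{ij})_{i,j=1}^3$ on $\mathbb D$ with $\|F(\lambda)\|\le1$ (operator norm) for all $\lambda\in\mathbb D$. $\mathcal S_3(\mathbb C,\mathbb C)$ is the Schur class of the tridisc, i.e. the set of analytic functions $f$ on $\mathbb D^3$ with $|f|\le1$. For $F\in \mathcal S_1(\mathbb C^3,\mathbb C^3)$, $$\mathcal G_{F(\lambda)}(z_1,z_2)=F_{11}(\lambda)+\begin{pmatrix}F_{12}(\lambda)&F_{13}(\lambda)\end{pmatrix}\begin{pmatrix}z_1&0\\ 0&z_2\end{pmatrix}\left(I_2-\begin{pmatrix}F_{22}(\lambda)&F_{23}(\lambda)\\ F_{32}(\lambda)&F_{33}(\lambda)\end{pmatrix}\begin{pmatrix}z_1&0\\ 0&z_2\end{pmatrix}\right)^{-1}\begin{pmatrix}F_{21}(\lambda)\\ F_{31}(\lambda)\end{pmatrix}$$ whenever the inverse exists. *)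

(* Defs.v *)
From HB Require Import structures.
From mathcomp Require Import all_boot all_order all_algebra.
From mathcomp Require Import all_classical all_reals all_analysis.
From mathcomp Require Import complex.

Set Implicit Arguments.
Unset Strict Implicit.
Unset Printing Implicit Defensive.

Import Order.TTheory GRing.Theory Num.Theory.
Import numFieldNormedType.Exports.

Local Open Scope classical_set_scope.
Local Open Scope complex_scope.
Local Open Scope ring_scope.

HB.instance Definition _ (R : realType) := NormedModule.copy R[i] R[i]^o.

(* Functions on an open set U are represented by total functions of which
   only the values on U matter. Differentiability is Frechet differentiability
   over the scalar field R[i], i.e., complex differentiability. *)
Definition analytic_on (R : realType) (V W : normedModType R[i])
    (U : set V) (f : V -> W) : Prop :=
  forall x, U x -> differentiable f x.

Definition unit_disc (R : realType) : set R[i] := [set z | `|z| < 1].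

Definition tridisc (R : realType) : set (R[i] * R[i] * R[i]) :=
  @unit_disc R `*` @unit_disc R `*` @unit_disc R.

Definition euclidean_norm (R : realType) (n : nat) (x : 'cV[R[i]]_n) : R :=
  Num.sqrt (\sum_(i < n) complex.Re `|x i 0| ^+ 2).

(* The norm that matrices carry in the library is the entrywise maximum. *)
Definition operator_norm (R : realType) (m n : nat)
    (A : 'M[R[i]]_(m, n)) : R :=
  sup [set euclidean_norm (A *m x) | x in
         [set x : 'cV[R[i]]_n | euclidean_norm x <= 1]].

Definition schur1 (R : realType) : set (R[i] -> 'M[R[i]]_3) :=
  [set F | analytic_on (@unit_disc R) F /\
           forall l, unit_disc l -> operator_norm (F l) <= 1].

Definition schur3 (R : realType) : set (R[i] * R[i] * R[i] -> R[i]) :=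
  [set f | analytic_on (@tridisc R) f /\
           forall p, tridisc p -> `|f p| <= 1].

Definition diag2 (R : realType) (z1 z2 : R[i]) : 'M[R[i]]_2 :=
  diag_mx (row_mx z1%:M z2%:M : 'rV[R[i]]_(1 + 1)).

(* The blocks of A are those of the decomposition 3 = 1 + 2; in particular
   drsubmx is the lower right 2 x 2 block. *)
Definition G_den (R : realType) (A : 'M[R[i]]_3) (z1 z2 : R[i]) : 'M[R[i]]_2 :=
  1%:M - drsubmx (A : 'M[R[i]]_(1 + 2)) *m diag2 z1 z2.

(* Meaningful only when G_den A z1 z2 is invertible: invmx is the identity on
   singular matrices. *)
Definition G (R : realType) (A : 'M[R[i]]_3) (z1 z2 : R[i]) : R[i] :=
  let A' : 'M[R[i]]_(1 + 2) := A in
  (ulsubmx A' + ursubmx A' *m diag2 z1 z2 *m invmx (G_den A z1 z2)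
                *m dlsubmx A') 0 0.

Definition SE (R : realType) (F : R[i] -> 'M[R[i]]_3)
    (p : R[i] * R[i] * R[i]) : R[i] :=
  let: (z1, z2, l) := p in - G (F l) z1 z2.

(* Main.v *)
Require Import Defs.
From mathcomp Require Import all_boot all_order all_algebra.
From mathcomp Require Import all_classical all_reals all_analysis.
From mathcomp Require Import complex.

Set Implicit Arguments.
Unset Strict Implicit.
Unset Printing Implicit Defensive.

Import Order.TTheory GRing.Theory Num.Theory.
Import numFieldNormedType.Exports.

Local Open Scope classical_set_scope.
Local Open Scope complex_scope.
Local Open Scope ring_scope.

(** The statement follows from one energy inequality. Let A = F(l), a contraction
split into blocks A11, A12, A21, A22 along C^3 = C + C^2, and let D be the
diagonal matrix with entries z1, z2, which strictly shrinks every nonzero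
vector.

If (1 - A22 D) y = 0, then A maps (0, D y) to a vector whose lower component is
A22 D y = y, so |y| <= |D y|, which forces y = 0: the inverse exists
([one_sub_block_diag_unit]).

For a scalar u, put y = (1 - A22 D)^-1 A21 u, i.e., y = A21 u + A22 D y. Then A
maps (u, D y) to (G u, y), so
  |G u|^2 + |y|^2 <= |u|^2 + |D y|^2 <= |u|^2 + |y|^2,
and |G u| <= |u| ([transfer_contraction]).

Since an inverse matrix is its adjugate divided by its determinant, near a point
of the tridisc G is a rational expression with nonvanishing denominator in z1,
z2 and the entries of F(l), hence it is complex differentiable
([differentiable_SE]). *)

(** * Differentiability of matrix expressions *)

(** [invmx] agrees with the adjugate formula only where the determinant does not
vanish, so differentiability has to be transported along an equality that holds
only near the point. *)
Lemma near_eq_differentiable (K : numFieldType) (V W : normedModType K)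
    (f g : V -> W) (x : V) :
  (\forall y \near x, f y = g y) -> differentiable f x -> differentiable g x.
Proof.
move=> fg df.
have gE : g \o shift x = cst (g x) + 'd f x +o_ 0 id.
  apply/eqaddoP => e e0.
  have /eqaddoP/(_ e e0) := diff_locally df.
  have fg0 : \forall h \near (0 : V), f (h + x) = g (h + x).
    move: fg; rewrite (near_shift 0).
    by apply: filterS => h /=; rewrite subr0.
  have fgx : f x = g x by exact: nbhs_singleton fg.
  apply: filterS2 fg0 => h fgh.
  by rewrite /= !fctE /= fgh fgx.
have dg : 'd g x = 'd f x :> (V -> W).
  by apply: diff_unique gE => //; exact: diff_continuous.
by apply/diff_locallyP; rewrite dg; split => //; exact: diff_continuous.
Qed.

Section EntrywiseDifferentiability.
Variables (R : realType) (V : normedModType R[i]) (p : V).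

Lemma differentiable_bigsum (I : Type) (r : seq I) (P : pred I)
    (f : I -> V -> R[i]) :
  (forall i, differentiable (f i) p) ->
  differentiable (fun q => \sum_(i <- r | P i) f i q) p.
Proof.
move=> df; elim: r => [|i r IH].
  by under eq_fun do rewrite big_nil; exact: differentiable_cst.
under eq_fun do rewrite big_cons.
by case: (P i) => //; exact: differentiableD.
Qed.

Lemma differentiable_bigprod (I : Type) (r : seq I) (P : pred I)
    (f : I -> V -> R[i]) :
  (forall i, differentiable (f i) p) ->
  differentiable (fun q => \prod_(i <- r | P i) f i q) p.
Proof.
move=> df; elim: r => [|i r IH].
  by under eq_fun do rewrite big_nil; exact: differentiable_cst.
under eq_fun do rewrite big_cons.
by case: (P i) => //; exact: differentiableM.
Qed.

(** Differentiability is tracked entry by entry: products, determinants and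
adjugates are polynomials in the entries, so this is the form in which it
propagates. *)
Definition entries_differentiable m n (M : V -> 'M[R[i]]_(m, n)) :=
  forall i j, differentiable (fun q => M q i j) p.

Lemma entries_differentiable_mulmx m n k (M : V -> 'M[R[i]]_(m, n))
    (N : V -> 'M[R[i]]_(n, k)) :
  entries_differentiable M -> entries_differentiable N ->
  entries_differentiable (fun q => M q *m N q).
Proof.
move=> dM dN i j; under eq_fun do rewrite mxE.
by apply: differentiable_bigsum => l; exact: differentiableM.
Qed.

Lemma differentiable_det n (M : V -> 'M[R[i]]_n) :
  entries_differentiable M -> differentiable (fun q => \det (M q)) p.
Proof.
move=> dM; rewrite /determinant; apply: differentiable_bigsum => s.
apply: differentiableM; first exact: differentiable_cst.
exact: differentiable_bigprod.
Qed.

Lemma entries_differentiable_adj n (M : V -> 'M[R[i]]_n) :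
  entries_differentiable M -> entries_differentiable (fun q => \adj (M q)).
Proof.
move=> dM i j; under eq_fun do rewrite mxE /cofactor.
apply: differentiableM; first exact: differentiable_cst.
by apply: differentiable_det => k l; under eq_fun do rewrite !mxE.
Qed.

Lemma entries_differentiable_inv n (M : V -> 'M[R[i]]_n) :
  M p \in unitmx -> entries_differentiable M ->
  entries_differentiable (fun q => invmx (M q)).
Proof.
move=> Mp dM i j; have ddet := differentiable_det dM.
have near_unit : \forall q \near p, \det (M q) != 0.
  have c := differentiable_continuous ddet.
  move: Mp; rewrite unitmxE unitfE => Mp.
  exact: cvgr_neq0 c Mp.
apply: (@near_eq_differentiable _ _ _
    (fun q => (\det (M q))^-1 * (\adj (M q)) i j)).
  apply: filterS near_unit => q Mq.
  by rewrite /invmx unitmxE unitfE Mq [in RHS]mxE.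
apply: differentiableM; last exact: entries_differentiable_adj.
by apply: differentiableV => //; exact: nbhs_singleton near_unit.
Qed.

End EntrywiseDifferentiability.

(** * Operator norm and squared Euclidean norm *)

Section SquaredNorm.
Variable R : realType.

(** The squared norm takes its values in R[i], like the modulus of a complex
number; it is additive on blocks and free of square roots. *)
Definition sqnorm n (x : 'cV[R[i]]_n) : R[i] := \sum_(i < n) `|x i 0| ^+ 2.

Lemma sqnorm_ge0 n (x : 'cV[R[i]]_n) : 0 <= sqnorm x.
Proof. by apply: sumr_ge0 => i _; rewrite exprn_ge0. Qed.

Lemma sqnorm0 n : sqnorm (0 : 'cV[R[i]]_n) = 0.
Proof. by apply: big1 => i _; rewrite mxE normr0 expr0n. Qed.

Lemma sqnorm_eq0 n (x : 'cV[R[i]]_n) : sqnorm x = 0 -> x = 0.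
Proof.
move/eqP; rewrite psumr_eq0 => [/allP x0|i _]; last by rewrite exprn_ge0.
apply/colP => i; apply/eqP; rewrite mxE.
by have := x0 i (mem_index_enum i); rewrite sqrf_eq0 normr_eq0.
Qed.

Lemma sqnormZ n (c : R[i]) (x : 'cV[R[i]]_n) :
  sqnorm (c *: x) = `|c| ^+ 2 * sqnorm x.
Proof.
by rewrite /sqnorm mulr_sumr; apply: eq_bigr => i _; rewrite mxE normrM exprMn.
Qed.

Lemma sqnorm_col_mx m n (u : 'cV[R[i]]_m) (v : 'cV[R[i]]_n) :
  sqnorm (col_mx u v) = sqnorm u + sqnorm v.
Proof.
rewrite /sqnorm big_split_ord /=.
by congr (_ + _); apply: eq_bigr => i _; rewrite ?col_mxEu ?col_mxEd.
Qed.

Lemma sqr_euclidean_norm n (x : 'cV[R[i]]_n) :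
  (euclidean_norm x ^+ 2)%:C = sqnorm x.
Proof.
rewrite /euclidean_norm sqr_sqrtr; last by apply: sumr_ge0 => i _; exact: sqr_ge0.
rewrite rmorph_sum; apply: eq_bigr => i _.
by rewrite rmorphXn.
Qed.

Lemma euclidean_norm_le m n (x : 'cV[R[i]]_m) (y : 'cV[R[i]]_n) :
  (euclidean_norm x <= euclidean_norm y) = (sqnorm x <= sqnorm y).
Proof.
by rewrite -!sqr_euclidean_norm lecR ler_sqr // nnegrE sqrtr_ge0.
Qed.

Lemma euclidean_norm_le1 n (x : 'cV[R[i]]_n) :
  (euclidean_norm x <= 1) = (sqnorm x <= 1).
Proof.
rewrite -sqr_euclidean_norm -(rmorph1 (real_complex R)) lecR.
by rewrite expr_le1 // sqrtr_ge0.
Qed.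

(** Without an upper bound on the set, its supremum would carry no information
about its elements. The bound comes from |x j| <= 1, which gives
|(A x) i| <= \sum_j |A i j|. *)
Lemma has_ubound_operator_norm m n (A : 'M[R[i]]_(m, n)) :
  has_ubound [set euclidean_norm (A *m x) | x in
    [set x : 'cV[R[i]]_n | euclidean_norm x <= 1]].
Proof.
pose b : 'cV[R[i]]_m := \col_i \sum_j `|A i j|.
exists (euclidean_norm b) => _ [x /= x1 <-].
rewrite euclidean_norm_le; apply: ler_sum => i _.
rewrite ler_sqr ?nnegrE // !mxE.
rewrite [leRHS]ger0_norm ?sumr_ge0 //.
apply: le_trans (ler_norm_sum _ _ _) _; apply: ler_sum => j _.
rewrite normrM ler_piMr // -(@expr_le1 _ 2) //.
rewrite euclidean_norm_le1 in x1; apply: le_trans x1.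
by rewrite /sqnorm (bigD1 j) //= lerDl sumr_ge0 // => k _; rewrite exprn_ge0.
Qed.

(** The operator norm only sees vectors in the unit ball; a nonzero x is brought
there by dividing it by its Euclidean norm t. *)
Lemma contraction_sqnorm m n (A : 'M[R[i]]_(m, n)) (x : 'cV[R[i]]_n) :
  operator_norm A <= 1 -> sqnorm (A *m x) <= sqnorm x.
Proof.
move=> A1; have [x0|x0] := eqVneq (sqnorm x) 0.
  by rewrite (sqnorm_eq0 x0) mulmx0 !sqnorm0.
pose t := (euclidean_norm x)%:C.
have tE : t ^+ 2 = sqnorm x by rewrite -sqr_euclidean_norm rmorphXn.
have t0 : t != 0 by rewrite -sqrf_eq0 tE.
have tV : sqnorm (t^-1 *: x) = 1.
  rewrite sqnormZ ger0_norm ?exprVn ?tE ?mulVf //.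
  by rewrite invr_ge0 ler0c sqrtr_ge0.
have : sqnorm (A *m (t^-1 *: x)) <= 1.
  rewrite -euclidean_norm_le1; apply: le_trans A1.
  apply: ub_le_sup; first exact: has_ubound_operator_norm.
  by exists (t^-1 *: x) => //=; rewrite euclidean_norm_le1 tV.
rewrite -scalemxAr sqnormZ ger0_norm; last by rewrite invr_ge0 ler0c sqrtr_ge0.
rewrite exprVn tE ler_pdivrMl ?mulr1 //.
by rewrite lt_neqAle eq_sym x0 sqnorm_ge0.
Qed.

End SquaredNorm.

(** * The transfer function of a contraction *)

Section TransferFunction.
Variables (R : realType) (m n : nat) (A : 'M[R[i]]_(m + n)) (d : 'rV[R[i]]_n).
Hypothesis contractA : forall x, sqnorm (A *m x) <= sqnorm x.
Hypothesis d_lt1 : forall j, `|d 0 j| < 1.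

Let D := diag_mx d.
Let den := 1%:M - drsubmx A *m D.

Lemma contraction_block (u : 'cV[R[i]]_m) (v : 'cV[R[i]]_n) :
  sqnorm (ulsubmx A *m u + ursubmx A *m v) +
  sqnorm (dlsubmx A *m u + drsubmx A *m v) <= sqnorm u + sqnorm v.
Proof.
by rewrite -!sqnorm_col_mx -mul_block_col submxK contractA.
Qed.

Lemma sqr_normr_diag_le (y : 'cV[R[i]]_n) j :
  `|(D *m y) j 0| ^+ 2 <= `|y j 0| ^+ 2.
Proof.
rewrite mul_diag_mx mxE normrM exprMn.
by rewrite ler_piMl ?exprn_ge0 // expr_le1 // ltW.
Qed.

Lemma sqnorm_diag_le (y : 'cV[R[i]]_n) : sqnorm (D *m y) <= sqnorm y.
Proof. by apply: ler_sum => j _; exact: sqr_normr_diag_le. Qed.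

(** Every coordinate of y is multiplied by a number of modulus less than 1, so a
nonzero coordinate makes the norm drop strictly. *)
Lemma sqnorm_le_diag_eq0 (y : 'cV[R[i]]_n) :
  sqnorm y <= sqnorm (D *m y) -> y = 0.
Proof.
move=> yD; apply/colP => j; rewrite mxE; apply/eqP/contraT => yj0.
suff /lt_geF : sqnorm (D *m y) < sqnorm y by rewrite yD.
rewrite /sqnorm (bigD1 j) //= [ltRHS](bigD1 j) //=; apply: ltr_leD.
  rewrite mul_diag_mx mxE normrM exprMn gtr_pMl ?exprn_gt0 ?normr_gt0 //.
  by rewrite expr_lt1.
by apply: ler_sum => k _; exact: sqr_normr_diag_le.
Qed.

(** A kernel vector y satisfies y = A22 D y, and A22 is a contraction as a block
of one, so |y| <= |D y|. *)
Lemma one_sub_block_diag_unit : den \in unitmx.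
Proof.
rewrite -unitmx_tr -row_free_unit; apply/inj_row_free => v vden.
have denv : den *m v^T = 0.
  by rewrite -(trmxK den) -trmx_mul vden trmx0.
apply: trmx_inj; rewrite trmx0; apply: sqnorm_le_diag_eq0.
have vE : v^T = drsubmx A *m (D *m v^T).
  by apply/eqP; rewrite -subr_eq0 mulmxA -{1}[v^T]mul1mx -mulmxBl denv.
have := contraction_block 0 (D *m v^T); rewrite !mulmx0 !add0r -vE.
by rewrite sqnorm0 add0r; apply: le_trans; rewrite lerDr sqnorm_ge0.
Qed.

(** The witness y = (1 - A22 D)^-1 A21 u is the lower component of A (u, D y),
whose upper component is the transfer function applied to u. Contractivity of A
on this vector, with |D y| <= |y|, bounds the upper component alone. *)
Lemma transfer_contraction (u : 'cV[R[i]]_m) :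
  sqnorm ((ulsubmx A + ursubmx A *m D *m invmx den *m dlsubmx A) *m u) <=
  sqnorm u.
Proof.
pose y := invmx den *m (dlsubmx A *m u).
have yE : dlsubmx A *m u + drsubmx A *m (D *m y) = y.
  have : den *m y = dlsubmx A *m u.
    by rewrite mulmxA mulmxV ?one_sub_block_diag_unit ?mul1mx.
  by rewrite mulmxBl mul1mx => <-; rewrite mulmxA subrK.
have := contraction_block u (D *m y); rewrite yE.
rewrite mulmxDl -!mulmxA -/y => energy_le.
rewrite -(lerD2r (sqnorm y)); apply: le_trans energy_le _.
by rewrite lerD2l sqnorm_diag_le.
Qed.

End TransferFunction.

(** * The map SE *)

Lemma unit_disc_diag (R : realType) (z1 z2 : R[i]) :
  unit_disc z1 -> unit_disc z2 ->
  forall j, `|(row_mx z1%:M z2%:M : 'rV[R[i]]_(1 + 1)) 0 j| < 1.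
Proof.
move=> z1_lt1 z2_lt1 j; rewrite mxE.
by case: fintype.split => k; rewrite ord1 mxE eqxx mulr1n.
Qed.

Lemma entries_differentiable_diag2 (R : realType) (V : normedModType R[i])
    (p : V) (f g : V -> R[i]) :
  differentiable f p -> differentiable g p ->
  entries_differentiable p (fun q => diag2 (f q) (g q)).
Proof.
move=> df dg i j; under eq_fun do rewrite mxE mxE.
case: (i == j); last by under eq_fun do rewrite mulr0n; exact: differentiable_cst.
under eq_fun do rewrite mulr1n.
by case: fintype.split => k; rewrite ord1; under eq_fun do rewrite mxE eqxx mulr1n.
Qed.

(** The adjugate formula for the inverse holds on a whole neighbourhood of p,
because the determinant is continuous and nonzero at p. *)
Lemma differentiable_SE (R : realType) (F : R[i] -> 'M[R[i]]_3)
    (p : R[i] * R[i] * R[i]) :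
  differentiable F p.2 -> G_den (F p.2) p.1.1 p.1.2 \in unitmx ->
  differentiable (SE F) p.
Proof.
move=> dF den_u.
have dfst (V W : normedModType R[i]) (q : V * W) : differentiable fst q.
  by apply: linear_differentiable => x; exact: cvg_fst.
have dsnd (V W : normedModType R[i]) (q : V * W) : differentiable snd q.
  by apply: linear_differentiable => x; exact: cvg_snd.
have dFij i j : differentiable (fun q : R[i] * R[i] * R[i] => F q.2 i j) p.
  apply: (@differentiable_comp _ _ _ _ (fun q : R[i] * R[i] * R[i] => F q.2)
     (fun M : 'M[R[i]]_3 => M i j)); last exact: differentiable_coord.
  exact: differentiable_comp.
have dD : entries_differentiable p
    (fun q : R[i] * R[i] * R[i] => diag2 q.1.1 q.1.2).
  by apply: entries_differentiable_diag2; exact: differentiable_comp.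
have dden : entries_differentiable p
    (fun q : R[i] * R[i] * R[i] => G_den (F q.2) q.1.1 q.1.2).
  move=> i j; rewrite /G_den; under eq_fun do rewrite mxE.
  apply: differentiableD; first exact: differentiable_cst.
  under eq_fun do rewrite mxE; apply: differentiableN.
  apply: (entries_differentiable_mulmx (p := p)
     (M := fun q => drsubmx (F q.2 : 'M[R[i]]_(1 + 2)))) => // k l.
  by under eq_fun do rewrite !mxE.
rewrite (_ : SE F = fun q => - G (F q.2) q.1.1 q.1.2); last first.
  by apply/funext => -[[]].
apply: differentiableN; rewrite /G; under eq_fun do rewrite mxE.
apply: differentiableD; first by under eq_fun do rewrite !mxE.
apply: (entries_differentiable_mulmx (p := p)
     (N := fun q => dlsubmx (F q.2 : 'M[R[i]]_(1 + 2)))); last first.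
  by move=> k l; under eq_fun do rewrite !mxE.
apply: entries_differentiable_mulmx; last exact: entries_differentiable_inv.
apply: entries_differentiable_mulmx => // k l.
by under eq_fun do rewrite !mxE.
Qed.

Theorem proposition2p2 (R : realType) (F : R[i] -> 'M[R[i]]_3) :
  schur1 F ->
  (forall z1 z2 l : R[i], unit_disc z1 -> unit_disc z2 -> unit_disc l ->
     G_den (F l) z1 z2 \in unitmx) /\
  schur3 (SE F).
Proof.
move=> [anF F_le1].
have contrF l : unit_disc l -> forall x, sqnorm (F l *m x) <= sqnorm x.
  by move=> l_lt1 x; exact: contraction_sqnorm (F_le1 l l_lt1).
have denF z1 z2 l : unit_disc z1 -> unit_disc z2 -> unit_disc l ->
    G_den (F l) z1 z2 \in unitmx.
  move=> z1_lt1 z2_lt1 l_lt1.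
  exact: (@one_sub_block_diag_unit R 1 2 _ _ (contrF l l_lt1)
    (unit_disc_diag z1_lt1 z2_lt1)).
split=> //; split=> [p [[p1 p2] p3]|[[z1 z2] l] [[/= z1_lt1 z2_lt1] l_lt1]].
  by apply: differentiable_SE; [exact: anF | exact: denF].
rewrite normrN /G -(@expr_le1 _ 2) //.
(* The scalar G is the image of the vector 1 under the transfer function. *)
have := @transfer_contraction R 1 2 _ _ (contrF l l_lt1)
  (unit_disc_diag z1_lt1 z2_lt1) 1%:M.
by rewrite mulmx1 /sqnorm !big_ord1 [X in _ <= `|X| ^+ 2]mxE eqxx normr1 expr1n.
Qed.
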